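(* Let $\lambda_a=0$ and $\lambda_x\ge 0$, and let $H_0=1$, $\delta_0=\frac14$. Consider the solution $(a(t),\delta(t))$ of $$\dot a=\frac{aH^3(1-4\delta)}{H^3/a+3\lambda_a(1-6\delta+12\delta^2)a^2+3\lambda_xH^2/a^2+18\lambda_a\lambda_x},$$ $$\dot\delta=\frac{-H^4/a-6\lambda_a aH^2}{H^3/a+3\lambda_a(1-6\delta+12\delta^2)a^2+3\lambda_xH^2/a^2+18\lambda_a\lambda_x},$$ where $H=a\delta(1-2\delta)$, with initial data $a(0)=\frac{H_0}{\delta_0(1-2\delta_0)}=8$ and $\delta(0)=\delta_0$. Then $H(t)\equiv H_0$, $\delta(t)$ decreases monotonically and tends to $0$ as $t\to T^-$, where $$T=\frac1{H_0}\int_0^{\delta_0}\Big(1+\frac{3\lambda_x}{H_0^2}\,\delta(1-2\delta)\Big)d\delta<\infty,$$ and $a(t)=\frac{H_0}{\delta(t)(1-2\delta(t))}\to+\infty$ as $t\to T^-$; that is, the parameter evolution blows up in finite time.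
   Context: The system is the SPIKE parameter evolution for Burgers' equation $\partial_tu+\partial_x(u^2/2)=0$ on $\mathbb{T}=\mathbb{R}/\mathbb{Z}$ with the two-kernel ansatz $u(x;\theta(t))=a(t)\varphi(x+\delta(t))-a(t)\varphi(x-\delta(t))$, $\varphi(x)=\frac12\{x\}^2-\frac12\{x\}+\frac1{12}$ ($\{x\}$ the fractional part), where $(\dot a,\dot\delta)$ minimizes $\int_{\mathbb{T}}(\partial_tu+\partial_x(u^2/2))^2dx+2\lambda_a\dot a^2+2\lambda_x\dot\delta^2$. *)

(* Defs.v *)
From Stdlib Require Import Reals.
From Coquelicot Require Import Coquelicot.
Open Scope R_scope.

(* The peak value u(-delta) of the two-kernel profile, for 0 <= delta <= 1/2. *)
Definition height (a delta : R) : R := a * delta * (1 - 2 * delta).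

Definition denom (la lx a delta : R) : R :=
  let H := height a delta in
  H ^ 3 / a
  + 3 * la * (1 - 6 * delta + 12 * delta ^ 2) * a ^ 2
  + 3 * lx * H ^ 2 / a ^ 2
  + 18 * la * lx.

Definition a_rhs (la lx a delta : R) : R :=
  let H := height a delta in
  a * H ^ 3 * (1 - 4 * delta) / denom la lx a delta.

Definition delta_rhs (la lx a delta : R) : R :=
  let H := height a delta in
  (- (H ^ 4) / a - 6 * la * a * H ^ 2) / denom la lx a delta.

(* The time interval [0, S), where S may be p_infty. *)
Definition life (S : Rbar) (t : R) : Prop := 0 <= t /\ Rbar_lt t S.

(* Solutions on [0, S).  [D_in] is the derivative relative to [0, S), hence
   one-sided at t = 0.  Since division is total, that the trajectory stays
   where the right-hand sides are defined is an explicit requirement. *)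
Definition solution (la lx a0 delta0 : R) (S : Rbar) (a delta : R -> R) : Prop :=
  Rbar_lt 0 S /\ a 0 = a0 /\ delta 0 = delta0 /\
  forall t : R, life S t ->
    a t <> 0 /\ denom la lx (a t) (delta t) <> 0 /\
    D_in a (fun s => a_rhs la lx (a s) (delta s)) (life S) t /\
    D_in delta (fun s => delta_rhs la lx (a s) (delta s)) (life S) t.

(* The values of a and delta outside [0, S) are irrelevant. *)
Definition maximal_solution (la lx a0 delta0 : R) (S : Rbar)
    (a delta : R -> R) : Prop :=
  solution la lx a0 delta0 S a delta /\
  forall (S' : Rbar) (a' delta' : R -> R),
    solution la lx a0 delta0 S' a' delta' ->
    (forall t : R, life S t -> life S' t -> a' t = a t /\ delta' t = delta t) ->
    Rbar_le S' S.

(* Main.v *)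
Require Import Defs.
From Stdlib Require Import Reals Lra.
From Coquelicot Require Import Coquelicot.
Open Scope R_scope.

(** When [la = 0], [height] is a first integral of the system, so it stays equal
    to 1 and the system reduces to [delta' = - a / (a + 3 lx)] with
    [a = 1 / (delta (1 - 2 delta))].  For the primitive [F] ([travel_time]) of
    [1 + 3 lx d (1 - 2 d)] vanishing at 0 this says [F (delta t) = F (1/4) - t].
    As [F] is increasing on [[0, 1/2]], this relation determines the solution,
    bounds its life span by [F (1/4)], and, read backwards, defines a solution
    on all of [[0, F (1/4))]. *)

Lemma life_le (S : Rbar) (s t : R) : 0 <= s <= t -> life S t -> life S s.
Proof.
  intros Hs [_ H]. split; [lra|].
  destruct S as [r| |]; simpl in *; try tauto; lra.
Qed.

Lemma life_neighborhood (S : Rbar) (t : R) :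
  life S t ->
  exists e, 0 < e /\ forall x, Rabs (x - t) < e -> life S (Rmax 0 x).
Proof.
  intros [H0 H]. destruct S as [r| |]; simpl in H; [|exists 1|tauto].
  - exists (r - t). split; [lra|]. intros x Hx.
    apply Rabs_def2 in Hx. split; [apply Rmax_l|]. simpl.
    apply Rmax_lub_lt; lra.
  - split; [lra|]. intros x _. split; [apply Rmax_l|exact I].
Qed.

Lemma D_in_eq (f d d' : R -> R) (D : R -> Prop) (x : R) :
  D_in f d D x -> d x = d' x -> D_in f d' D x.
Proof. unfold D_in. intros H E. rewrite <- E. exact H. Qed.

(* Freezing a function on [[0, S)] at its initial value for negative arguments
   turns one-sided regularity at 0 into two-sided regularity. *)
Lemma D_in_continuity_clamp (S : Rbar) (g d : R -> R) (t : R) :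
  life S t -> D_in g d (life S) t -> continuity_pt (fun x => g (Rmax 0 x)) t.
Proof.
  intros Ht H. apply cont_deriv in H.
  destruct (life_neighborhood S t Ht) as [e [He Hn]].
  assert (Et : Rmax 0 t = t) by (apply Rmax_right, Ht).
  intros eps Heps. destruct (H eps Heps) as [alp [Halp Hc]].
  exists (Rmin alp e). split; [apply Rmin_pos; assumption|].
  intros x [_ Hx]. simpl in *. unfold Rdist in *. rewrite Et.
  destruct (Req_dec (Rmax 0 x) t) as [E|N].
  - rewrite E, Rminus_diag, Rabs_R0. exact Heps.
  - apply Hc. repeat split.
    + apply Rmax_l.
    + apply Hn. exact (Rlt_le_trans _ _ _ Hx (Rmin_r _ _)).
    + auto.
    + apply Rle_lt_trans with (Rabs (x - t)).
      * destruct Ht as [Ht _]. unfold Rmax, Rabs.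
        destruct (Rle_dec 0 x); repeat destruct (Rcase_abs _); lra.
      * exact (Rlt_le_trans _ _ _ Hx (Rmin_l _ _)).
Qed.

Lemma D_in_derivable_clamp (S : Rbar) (g d : R -> R) (t : R) :
  0 < t -> life S t -> D_in g d (life S) t ->
  derivable_pt_lim (fun x => g (Rmax 0 x)) t (d t).
Proof.
  intros H0 Ht H.
  destruct (life_neighborhood S t Ht) as [e [He Hn]].
  intros eps Heps. destruct (H eps Heps) as [alp [Halp Hc]].
  assert (Hp : 0 < Rmin t (Rmin alp e)) by (repeat apply Rmin_pos; assumption).
  exists (mkposreal _ Hp). intros h Hh0 Hh. simpl in Hh.
  assert (A1 : Rabs h < t) by (eapply Rlt_le_trans; [exact Hh|apply Rmin_l]).
  assert (A2 : Rabs h < Rmin alp e)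
    by (eapply Rlt_le_trans; [exact Hh|apply Rmin_r]).
  assert (A3 : Rabs h < alp) by (eapply Rlt_le_trans; [exact A2|apply Rmin_l]).
  assert (A4 : Rabs h < e) by (eapply Rlt_le_trans; [exact A2|apply Rmin_r]).
  assert (Eh : t + h - t = h) by ring.
  apply Rabs_def2 in A1.
  specialize (Hn (t + h)). rewrite Eh in Hn. specialize (Hn A4).
  rewrite !Rmax_right in * by lra.
  specialize (Hc (t + h)). simpl in Hc. unfold Rdist in Hc. rewrite Eh in Hc.
  apply Hc. repeat split; try (apply Hn); try assumption. lra.
Qed.

Lemma D_in_0_constant (S : Rbar) (g : R -> R) :
  (forall t, life S t -> D_in g (fun _ => 0) (life S) t) ->
  forall t, life S t -> g t = g 0.
Proof.
  intros H t Ht. destruct (Req_dec t 0) as [->|N]; [reflexivity|].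
  assert (0 < t) by (destruct Ht; lra).
  destruct (MVT_gen (fun x => g (Rmax 0 x)) 0 t (fun _ => 0)) as [c [_ E]].
  - rewrite Rmin_left, Rmax_right by lra. intros x Hx.
    apply is_derive_Reals.
    apply (D_in_derivable_clamp S g (fun _ => 0)); [lra| |];
      [|apply H]; apply (life_le S x t); auto; lra.
  - rewrite Rmin_left, Rmax_right by lra. intros x Hx.
    apply (D_in_continuity_clamp S g (fun _ => 0)); [|apply H];
      apply (life_le S x t); auto; lra.
  - rewrite (Rmax_right 0 t), (Rmax_right 0 0) in E by lra. lra.
Qed.

Lemma D_in_nonvanishing_pos (S : Rbar) (g d : R -> R) :
  0 < g 0 ->
  (forall t, life S t -> g t <> 0 /\ D_in g d (life S) t) ->
  forall t, life S t -> 0 < g t.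
Proof.
  intros Hg H t Ht. destruct (Rlt_or_le 0 (g t)) as [|Hle]; [assumption|].
  exfalso.
  assert (Hlt : g t < 0) by (destruct (H t Ht); lra).
  assert (0 < t) by
    (destruct Ht; destruct (Req_dec t 0) as [->|]; lra).
  destruct (Ranalysis5.IVT_interv (fun x => - g (Rmax 0 x)) 0 t) as [z [Hz Ez]].
  - intros x Hx. apply (continuity_pt_opp (fun x => g (Rmax 0 x))).
    assert (Lx : life S x) by (apply (life_le S x t); auto).
    apply (D_in_continuity_clamp S g d); auto. apply H; auto.
  - lra.
  - rewrite Rmax_right; lra.
  - rewrite Rmax_right; lra.
  - assert (Lz : life S z) by (apply (life_le S z t); auto).
    rewrite Rmax_right in Ez by lra. destruct (H z Lz). lra.
Qed.

Definition travel_time (lx d : R) : R :=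
  d + 3 * lx * (d ^ 2 / 2 - 2 * d ^ 3 / 3).

Definition travel_slope (lx x y : R) : R :=
  1 + 3 * lx * ((x + y) / 2 - 2 / 3 * (x ^ 2 + x * y + y ^ 2)).

Lemma travel_time_minus (lx x y : R) :
  travel_time lx x - travel_time lx y = (x - y) * travel_slope lx x y.
Proof. unfold travel_time, travel_slope. field. Qed.

Lemma travel_slope_ge_1 (lx x y : R) :
  0 <= lx -> 0 <= x <= 1 / 2 -> 0 <= y <= 1 / 2 -> 1 <= travel_slope lx x y.
Proof.
  intros Hl Hx Hy. unfold travel_slope.
  assert (0 <= (x + y) / 2 - 2 / 3 * (x ^ 2 + x * y + y ^ 2)) by nra.
  assert (0 <= lx * ((x + y) / 2 - 2 / 3 * (x ^ 2 + x * y + y ^ 2)))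
    by (apply Rmult_le_pos; assumption).
  lra.
Qed.

Lemma travel_time_lt (lx x y : R) :
  0 <= lx -> 0 <= x <= 1 / 2 -> 0 <= y <= 1 / 2 ->
  travel_time lx x < travel_time lx y -> x < y.
Proof.
  intros Hl Hx Hy H. generalize (travel_time_minus lx x y).
  generalize (travel_slope_ge_1 lx x y Hl Hx Hy). nra.
Qed.

Lemma travel_time_inj (lx x y : R) :
  0 <= lx -> 0 <= x <= 1 / 2 -> 0 <= y <= 1 / 2 ->
  travel_time lx x = travel_time lx y -> x = y.
Proof.
  intros Hl Hx Hy H. generalize (travel_time_minus lx x y).
  generalize (travel_slope_ge_1 lx x y Hl Hx Hy). nra.
Qed.

Lemma travel_time_0 (lx : R) : travel_time lx 0 = 0.
Proof. unfold travel_time. field. Qed.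

Lemma travel_time_ge (lx d : R) :
  0 <= lx -> 0 <= d <= 1 / 2 -> d <= travel_time lx d.
Proof.
  intros Hl Hd. generalize (travel_time_minus lx d 0). rewrite travel_time_0.
  generalize (travel_slope_ge_1 lx d 0 Hl Hd). nra.
Qed.

Lemma is_RInt_travel_time (lx d : R) :
  is_RInt (fun x => 1 + 3 * lx / 1 ^ 2 * (x * (1 - 2 * x))) 0 d
    (travel_time lx d).
Proof.
  replace (travel_time lx d) with (minus (travel_time lx d) (travel_time lx 0))
    by (rewrite travel_time_0; unfold minus, plus, opp; simpl; ring).
  apply (is_RInt_derive (travel_time lx)).
  - intros x _. unfold travel_time. auto_derive; [trivial|field].
  - intros x _. apply continuity_pt_filterlim. reg.
Qed.

Lemma denom_la0 (lx a d : R) :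
  a <> 0 ->
  denom 0 lx a d = (height a d / a) ^ 2 * (a * height a d + 3 * lx).
Proof. intros Ha. unfold denom. field. exact Ha. Qed.

Lemma denom_la0_neq0 (lx a d : R) :
  a <> 0 -> denom 0 lx a d <> 0 ->
  height a d <> 0 /\ a * height a d + 3 * lx <> 0.
Proof.
  intros Ha. rewrite denom_la0 by exact Ha. intros Hd. split; intros E; apply Hd.
  - rewrite E. field. exact Ha.
  - rewrite E. ring.
Qed.

Lemma a_rhs_la0 (lx a d : R) :
  a <> 0 -> denom 0 lx a d <> 0 ->
  a_rhs 0 lx a d
  = a ^ 3 * height a d * (1 - 4 * d) / (a * height a d + 3 * lx).
Proof.
  intros Ha Hd. destruct (denom_la0_neq0 lx a d Ha Hd).
  unfold a_rhs. rewrite denom_la0 by exact Ha. field. auto.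
Qed.

Lemma delta_rhs_la0 (lx a d : R) :
  a <> 0 -> denom 0 lx a d <> 0 ->
  delta_rhs 0 lx a d = - (a * height a d ^ 2) / (a * height a d + 3 * lx).
Proof.
  intros Ha Hd. destruct (denom_la0_neq0 lx a d Ha Hd).
  unfold delta_rhs. rewrite denom_la0 by exact Ha. field. auto.
Qed.

Lemma D_in_height (a a' delta delta' : R -> R) (D : R -> Prop) (t : R) :
  D_in a a' D t -> D_in delta delta' D t ->
  D_in (fun s => height (a s) (delta s))
    (fun s => a' s * (delta s * (1 - 2 * delta s))
              + a s * (1 - 4 * delta s) * delta' s) D t.
Proof.
  intros Ha Hd. unfold height.
  generalize (Dmult D _ _ _ _ t (Dmult D _ _ _ _ t Ha Hd)
    (Dminus D _ _ _ _ t (Dconst D 1 t) (Dmult_const D _ _ t 2 Hd))).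
  intros H. apply (D_in_eq _ _ _ _ _ H). ring.
Qed.

Lemma D_in_travel_time (lx : R) (delta delta' : R -> R) (D : R -> Prop) (t : R) :
  D_in delta delta' D t ->
  D_in (fun s => travel_time lx (delta s))
    (fun s => (1 + 3 * lx * (delta s * (1 - 2 * delta s))) * delta' s) D t.
Proof.
  intros Hd.
  generalize (Dadd D _ _ _ _ t Hd (Dmult D _ _ _ _ t (Dmult D _ _ _ _ t Hd Hd)
    (Dminus D _ _ _ _ t (Dconst D (3 * lx / 2) t)
       (Dmult_const D _ _ t (2 * lx) Hd)))).
  intros H. apply D_in_eq with (d' := fun s =>
    (1 + 3 * lx * (delta s * (1 - 2 * delta s))) * delta' s) in H; [|field].
  intros eps Heps. destruct (H eps Heps) as [alp [Halp Hc]].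
  exists alp. split; [exact Halp|]. intros x Hx. unfold travel_time.
  specialize (Hc x Hx). simpl in *.
  replace (delta x + 3 * lx * (delta x * (delta x * 1) / 2
             - 2 * (delta x * (delta x * (delta x * 1))) / 3))
    with (delta x + delta x * delta x * (3 * lx / 2 - 2 * lx * delta x)) by field.
  replace (delta t + 3 * lx * (delta t * (delta t * 1) / 2
             - 2 * (delta t * (delta t * (delta t * 1))) / 3))
    with (delta t + delta t * delta t * (3 * lx / 2 - 2 * lx * delta t)) by field.
  exact Hc.
Qed.

Lemma solution_first_integrals (lx : R) (S : Rbar) (a delta : R -> R) :
  0 <= lx -> solution 0 lx 8 (1 / 4) S a delta ->
  forall t, life S t ->
    0 < a t /\ height (a t) (delta t) = 1 /\ 0 < delta t < 1 / 2 /\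
    travel_time lx (delta t) = travel_time lx (1 / 4) - t.
Proof.
  intros Hl [HS [Ha0 [Hd0 Hsol]]].
  assert (Pos : forall t, life S t -> 0 < a t).
  { apply D_in_nonvanishing_pos with
      (d := fun s => a_rhs 0 lx (a s) (delta s)); [lra|].
    intros t Ht. destruct (Hsol t Ht) as [? [? [? ?]]]. auto. }
  assert (Hh : forall t, life S t -> height (a t) (delta t) = 1).
  { intros t Ht.
    rewrite (D_in_0_constant S (fun s => height (a s) (delta s))); trivial.
    - rewrite Ha0, Hd0. unfold height. field.
    - intros s Hs. destruct (Hsol s Hs) as [Na [Nd [Da Dd]]].
      apply D_in_eq with (1 := D_in_height _ _ _ _ _ _ Da Dd).
      rewrite a_rhs_la0, delta_rhs_la0 by assumption.
      destruct (denom_la0_neq0 lx _ _ Na Nd) as [_ N].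
      unfold height in *. field. exact N. }
  intros t Ht. split; [|split; [|split]]; auto.
  - specialize (Pos t Ht). specialize (Hh t Ht). unfold height in Hh.
    assert (0 < delta t * (1 - 2 * delta t)) by nra. nra.
  - enough (E : travel_time lx (delta t) + t = travel_time lx (delta 0) + 0)
      by (rewrite Hd0 in E; lra).
    apply (D_in_0_constant S (fun s => travel_time lx (delta s) + s)); trivial.
    intros s Hs. destruct (Hsol s Hs) as [Na [Nd [_ Dd]]].
    apply D_in_eq with
      (1 := Dadd _ _ _ _ _ _ (D_in_travel_time lx _ _ _ _ Dd) (Dx _ s)).
    rewrite delta_rhs_la0 by assumption.
    specialize (Pos s Hs). specialize (Hh s Hs). rewrite Hh.
    replace (delta s * (1 - 2 * delta s)) with (/ a s).
    + field. lra.
    + unfold height in Hh. apply Rmult_eq_reg_l with (a s); [|lra].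
      rewrite Rinv_r by lra. lra.
Qed.

Lemma solution_a_eq (lx : R) (S : Rbar) (a delta : R -> R) (t : R) :
  0 <= lx -> solution 0 lx 8 (1 / 4) S a delta -> life S t ->
  delta t * (1 - 2 * delta t) <> 0 /\
  a t = 1 / (delta t * (1 - 2 * delta t)).
Proof.
  intros Hl Hs Ht.
  destruct (solution_first_integrals lx S a delta Hl Hs t Ht)
    as [_ [Hh [Hd _]]].
  assert (N : 0 < delta t * (1 - 2 * delta t)) by (apply Rmult_lt_0_compat; lra).
  split; [lra|]. unfold height in Hh.
  apply Rmult_eq_reg_r with (delta t * (1 - 2 * delta t)); [|lra].
  unfold Rdiv. rewrite Rmult_assoc, Rinv_l by lra. lra.
Qed.

Lemma solution_unique (lx : R) (S1 S2 : Rbar) (a1 delta1 a2 delta2 : R -> R)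
    (t : R) :
  0 <= lx ->
  solution 0 lx 8 (1 / 4) S1 a1 delta1 -> solution 0 lx 8 (1 / 4) S2 a2 delta2 ->
  life S1 t -> life S2 t -> a1 t = a2 t /\ delta1 t = delta2 t.
Proof.
  intros Hl H1 H2 L1 L2.
  assert (E : delta1 t = delta2 t).
  { destruct (solution_first_integrals _ _ _ _ Hl H1 t L1) as [_ [_ [B1 F1]]].
    destruct (solution_first_integrals _ _ _ _ Hl H2 t L2) as [_ [_ [B2 F2]]].
    apply (travel_time_inj lx); lra. }
  split; [|exact E].
  destruct (solution_a_eq _ _ _ _ t Hl H1 L1) as [_ ->].
  destruct (solution_a_eq _ _ _ _ t Hl H2 L2) as [_ ->].
  rewrite E. reflexivity.
Qed.

Lemma solution_life_bound (lx : R) (S : Rbar) (a delta : R -> R) :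
  0 <= lx -> solution 0 lx 8 (1 / 4) S a delta ->
  Rbar_le S (travel_time lx (1 / 4)).
Proof.
  intros Hl H. apply Rbar_not_lt_le. intros C.
  assert (P : 1 / 4 <= travel_time lx (1 / 4)) by (apply travel_time_ge; lra).
  assert (L : life S (travel_time lx (1 / 4))) by (split; [lra|exact C]).
  destruct (solution_first_integrals _ _ _ _ Hl H _ L) as [_ [_ [B F]]].
  assert (delta (travel_time lx (1 / 4))
          <= travel_time lx (delta (travel_time lx (1 / 4))))
    by (apply travel_time_ge; lra).
  lra.
Qed.

Lemma travel_time_preimage (lx y : R) :
  0 <= y <= travel_time lx (1 / 4) ->
  {d | 0 <= d <= 1 / 4 /\ travel_time lx d = y}.
Proof.
  intros Hy.
  destruct (IVT_cor (fun d => travel_time lx d - y) 0 (1 / 4)) as [d [Hd E]].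
  - unfold travel_time. reg.
  - lra.
  - rewrite travel_time_0. nra.
  - exists d. split; [exact Hd|lra].
Qed.

Lemma travel_time_inverse (lx : R) :
  exists delta : R -> R, forall t, 0 <= t <= travel_time lx (1 / 4) ->
    0 <= delta t <= 1 / 4 /\
    travel_time lx (delta t) = travel_time lx (1 / 4) - t.
Proof.
  assert (H : forall t, {d | 0 <= t <= travel_time lx (1 / 4) ->
    0 <= d <= 1 / 4 /\ travel_time lx d = travel_time lx (1 / 4) - t}).
  { intros t. destruct (Rle_dec 0 t); [destruct (Rle_dec t (travel_time lx (1 / 4)))|].
    - destruct (travel_time_preimage lx (travel_time lx (1 / 4) - t)) as [d Hd];
        [lra|exists d; auto].
    - exists 0; lra.
    - exists 0; lra. }
  exists (fun t => proj1_sig (H t)). intros t. exact (proj2_sig (H t)).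
Qed.

Lemma limit1_in_ext (f g : R -> R) (D : R -> Prop) (l x : R) :
  (forall y, D y -> f y = g y) -> limit1_in f D l x -> limit1_in g D l x.
Proof.
  intros E H eps Heps. destruct (H eps Heps) as [alp [Halp Hc]].
  exists alp. split; [exact Halp|]. intros y Hy. rewrite <- E by apply Hy.
  apply Hc, Hy.
Qed.

Lemma travel_time_inverse_D_in (lx T : R) (delta : R -> R) (D : R -> Prop) (t : R) :
  0 <= lx -> D t ->
  (forall s, D s -> 0 <= delta s <= 1 / 2 /\ travel_time lx (delta s) = T - s) ->
  D_in delta (fun s => - / (1 + 3 * lx * (delta s * (1 - 2 * delta s)))) D t.
Proof.
  intros Hl Ht H. destruct (H t Ht) as [Bt Ft].
  assert (C : limit1_in delta (D_x D t) (delta t) t).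
  { intros eps Heps. exists eps. split; [exact Heps|].
    intros s [[Ds _] Hs]. simpl in *. unfold Rdist in *.
    destruct (H s Ds) as [Bs Fs].
    refine (Rle_lt_trans _ _ _ _ Hs).
    generalize (travel_time_minus lx (delta s) (delta t)).
    generalize (travel_slope_ge_1 lx (delta s) (delta t) Hl Bs Bt).
    intros Hm E. replace (s - t) with (- (T - s - (T - t))) by ring.
    rewrite <- Fs, <- Ft, E, Rabs_Ropp, Rabs_mult.
    rewrite (Rabs_pos_eq (travel_slope _ _ _)) by lra.
    generalize (Rabs_pos (delta s - delta t)). nra. }
  unfold D_in.
  apply limit1_in_ext with (f := fun s => - / travel_slope lx (delta s) (delta t)).
  { intros s [Ds Ns]. destruct (H s Ds) as [Bs Fs].
    generalize (travel_time_minus lx (delta s) (delta t)).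
    generalize (travel_slope_ge_1 lx (delta s) (delta t) Hl Bs Bt).
    intros Hm E.
    assert (s - t = - (travel_time lx (delta s) - travel_time lx (delta t))) as ->
      by lra.
    rewrite E. field. split; [lra|]. intros E0. apply Ns. rewrite E0 in E. lra. }
  replace (1 + 3 * lx * (delta t * (1 - 2 * delta t)))
    with (travel_slope lx (delta t) (delta t)) by (unfold travel_slope; field).
  assert (P : continuity_pt (fun x => - / travel_slope lx x (delta t)) (delta t)).
  { apply continuity_pt_opp with (f := fun x => / travel_slope lx x (delta t)).
    apply continuity_pt_inv.
    - unfold travel_slope. reg.
    - generalize (travel_slope_ge_1 lx _ _ Hl Bt Bt). lra. }
  intros eps Heps. destruct (P eps Heps) as [e [He HP]].
  destruct (C e He) as [alp [Halp Hc]].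
  exists alp. split; [exact Halp|]. intros s Hs. specialize (Hc s Hs).
  destruct (Req_dec (delta t) (delta s)) as [E|N].
  - rewrite <- E. simpl. unfold Rdist. rewrite Rminus_diag, Rabs_R0. exact Heps.
  - apply HP. split; [split; [exact I|exact N]|exact Hc].
Qed.

Lemma D_in_inv (f d : R -> R) (D : R -> Prop) (t : R) :
  D t -> D_in f d D t -> (forall s, D s -> f s <> 0) ->
  D_in (fun s => / f s) (fun s => - d s / f s ^ 2) D t.
Proof.
  intros Ht H N. assert (C := cont_deriv _ _ _ _ H).
  unfold D_in.
  apply limit1_in_ext with
    (f := fun s => (- ((f s - f t) / (s - t))) * / (f s * f t)).
  { intros s [Ds Ns]. field. repeat split; auto. lra. }
  assert (Nt := N t Ht).
  replace (- d t / f t ^ 2) with ((- d t) * / (f t * f t)) by (field; exact Nt).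
  apply limit_mul.
  - apply limit_Ropp. exact H.
  - apply limit_inv; [|apply Rmult_integral_contrapositive; auto].
    apply limit_mul; [exact C|].
    exact (limit_free f _ t t).
Qed.

Lemma solution_exists (lx : R) :
  0 <= lx ->
  exists a delta, solution 0 lx 8 (1 / 4) (travel_time lx (1 / 4)) a delta.
Proof.
  intros Hl. destruct (travel_time_inverse lx) as [delta Hdelta].
  assert (P : 1 / 4 <= travel_time lx (1 / 4)) by (apply travel_time_ge; lra).
  set (T := travel_time lx (1 / 4)) in *.
  assert (B : forall t, life T t ->
    0 < delta t <= 1 / 4 /\ travel_time lx (delta t) = T - t).
  { intros t [H0 H1]. simpl in H1. destruct (Hdelta t) as [Hd E]; [lra|].
    split; [|exact E].
    destruct (Req_dec (delta t) 0) as [Z|]; [|lra].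
    rewrite Z, travel_time_0 in E. lra. }
  assert (W : forall t, life T t -> 0 < delta t * (1 - 2 * delta t)).
  { intros t Ht. destruct (B t Ht). apply Rmult_lt_0_compat; lra. }
  assert (E0 : delta 0 = 1 / 4).
  { destruct (Hdelta 0) as [Hd E]; [lra|].
    apply (travel_time_inj lx); try lra. rewrite E. unfold T. ring. }
  exists (fun t => / (delta t * (1 - 2 * delta t))), delta.
  split; [simpl; lra|]. split; [rewrite E0; field|]. split; [exact E0|].
  intros t Ht. specialize (W t Ht) as Wt.
  assert (Nl : 1 + 3 * lx * (delta t * (1 - 2 * delta t)) <> 0) by
    (generalize (Rmult_le_pos _ _ Hl (Rlt_le _ _ Wt)); lra).
  assert (Na : / (delta t * (1 - 2 * delta t)) <> 0)
    by (apply Rinv_neq_0_compat; lra).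
  assert (Hh : height (/ (delta t * (1 - 2 * delta t))) (delta t) = 1)
    by (unfold height; rewrite Rmult_assoc; apply Rinv_l; lra).
  assert (Na' : / (delta t * (1 - 2 * delta t)) + 3 * lx <> 0).
  { generalize (Rinv_0_lt_compat _ Wt). lra. }
  assert (Nd : denom 0 lx (/ (delta t * (1 - 2 * delta t))) (delta t) <> 0).
  { rewrite denom_la0, Hh, Rmult_1_r by exact Na.
    apply Rmult_integral_contrapositive. split; [|exact Na'].
    apply pow_nonzero. unfold Rdiv. rewrite Rmult_1_l.
    apply Rinv_neq_0_compat, Na. }
  assert (Dd : D_in delta
    (fun s => - / (1 + 3 * lx * (delta s * (1 - 2 * delta s)))) (life T) t).
  { apply travel_time_inverse_D_in with T; trivial.
    intros s Hs. destruct (B s Hs). split; [lra|assumption]. }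
  assert (Nf : delta t <> 0 /\ 1 - 2 * delta t <> 0) by
    (destruct (B t Ht); split; lra).
  destruct Nf as [Nf1 Nf2].
  split; [exact Na|]. split; [exact Nd|]. split.
  - assert (Dp := Dmult _ _ _ _ _ _ Dd (Dminus _ _ _ _ _ _ (Dconst _ 1 t)
      (Dmult_const _ _ _ _ 2 Dd))).
    apply D_in_inv in Dp; [|exact Ht|intros s Hs; generalize (W s Hs); lra].
    apply (D_in_eq _ _ _ _ _ Dp).
    rewrite a_rhs_la0, Hh by assumption. field.
    repeat split; trivial; intros Z; apply Nl; rewrite <- Z; ring.
  - apply (D_in_eq _ _ _ _ _ Dd).
    rewrite delta_rhs_la0, Hh by assumption. field.
    repeat split; trivial; intros Z; apply Nl; rewrite <- Z; ring.
Qed.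

Lemma maximal_solution_exists (lx : R) :
  0 <= lx ->
  exists a delta,
    maximal_solution 0 lx 8 (1 / 4) (travel_time lx (1 / 4)) a delta.
Proof.
  intros Hl. destruct (solution_exists lx Hl) as [a [delta H]].
  exists a, delta. split; [exact H|]. intros S' a' delta' H' _.
  exact (solution_life_bound _ _ _ _ Hl H').
Qed.

Lemma maximal_solution_life (lx : R) (S : Rbar) (a delta : R -> R) :
  0 <= lx -> maximal_solution 0 lx 8 (1 / 4) S a delta ->
  S = travel_time lx (1 / 4).
Proof.
  intros Hl [H Hmax]. apply Rbar_le_antisym.
  - exact (solution_life_bound _ _ _ _ Hl H).
  - destruct (solution_exists lx Hl) as [a' [delta' H']].
    apply (Hmax _ a' delta' H'). intros t L L'.
    exact (solution_unique _ _ _ _ _ _ _ t Hl H' H L' L).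
Qed.

Lemma at_left_intro (x e : R) (P : R -> Prop) :
  0 < e -> (forall y, x - e < y < x -> P y) -> at_left x P.
Proof.
  intros He H. exists (mkposreal e He). intros y Hy Hlt.
  apply Rabs_def2 in Hy. simpl in Hy. unfold minus, plus, opp in Hy. simpl in Hy.
  apply H. lra.
Qed.

Theorem mainTheorem3 (la lx : R) (hla : la = 0) (hlx : 0 <= lx) :
  let H0 := 1 in
  let delta0 := 1 / 4 in
  let a0 := H0 / (delta0 * (1 - 2 * delta0)) in
  let f := fun d : R => 1 + 3 * lx / H0 ^ 2 * (d * (1 - 2 * d)) in
  let T := 1 / H0 * RInt f 0 delta0 in
  a0 = 8 /\
  ex_RInt f 0 delta0 /\
  (exists (S : Rbar) (a delta : R -> R),
     maximal_solution la lx a0 delta0 S a delta) /\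
  (forall (S1 S2 : Rbar) (a1 delta1 a2 delta2 : R -> R),
     solution la lx a0 delta0 S1 a1 delta1 ->
     solution la lx a0 delta0 S2 a2 delta2 ->
     forall t : R, life S1 t -> life S2 t ->
       a1 t = a2 t /\ delta1 t = delta2 t) /\
  (forall (S : Rbar) (a delta : R -> R),
     maximal_solution la lx a0 delta0 S a delta ->
     S = Finite T /\
     (forall t : R, 0 <= t < T -> height (a t) (delta t) = H0) /\
     (forall s t : R, 0 <= s -> s < t -> t < T -> delta t < delta s) /\
     filterlim delta (at_left T) (locally 0) /\
     (forall t : R, 0 <= t < T ->
        delta t * (1 - 2 * delta t) <> 0 /\
        a t = H0 / (delta t * (1 - 2 * delta t))) /\
     filterlim a (at_left T) (Rbar_locally p_infty)).
Proof.
  intros H0 delta0 a0 f T. subst la.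
  assert (Ea : a0 = 8) by (unfold a0, H0, delta0; field).
  assert (I : is_RInt f 0 delta0 (travel_time lx (1 / 4)))
    by apply is_RInt_travel_time.
  assert (ET : T = travel_time lx (1 / 4)).
  { unfold T, H0. rewrite (is_RInt_unique _ _ _ _ I). field. }
  clearbody T. subst T. rewrite Ea. unfold delta0.
  split; [reflexivity|]. split; [eexists; exact I|]. split; [|split].
  - destruct (maximal_solution_exists lx hlx) as [a [delta H]].
    exists (travel_time lx (1 / 4)), a, delta. exact H.
  - intros S1 S2 a1 delta1 a2 delta2 H1 H2 t L1 L2.
    exact (solution_unique _ _ _ _ _ _ _ t hlx H1 H2 L1 L2).
  - intros S a delta Hm.
    assert (ES := maximal_solution_life _ _ _ _ hlx Hm). subst S.
    destruct Hm as [Hs _].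
    assert (P : 1 / 4 <= travel_time lx (1 / 4)) by (apply travel_time_ge; lra).
    set (T := travel_time lx (1 / 4)) in *.
    assert (K : forall t, 0 <= t < T ->
      0 < a t /\ height (a t) (delta t) = 1 /\ 0 < delta t < 1 / 2 /\
      travel_time lx (delta t) = T - t)
      by exact (solution_first_integrals _ _ _ _ hlx Hs).
    assert (B : forall t, 0 <= t < T -> 0 < delta t <= T - t).
    { intros t Ht. destruct (K t Ht) as [_ [_ [Hd <-]]].
      split; [|apply travel_time_ge]; lra. }
    split; [reflexivity|]. split; [|split; [|split; [|split]]].
    + intros t Ht. apply K, Ht.
    + intros s t H1 H2 H3.
      destruct (K s) as [_ [_ [Bs Fs]]]; [lra|].
      destruct (K t) as [_ [_ [Bt Ft]]]; [lra|].
      apply (travel_time_lt lx); lra.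
    + intros Q [e He].
      apply at_left_intro with (Rmin e (1 / 4)).
      { apply Rmin_pos; [apply cond_pos|lra]. }
      intros y Hy. apply He.
      generalize (Rmin_l e (1 / 4)) (Rmin_r e (1 / 4)). intros M1 M2.
      destruct (B y) as [B1 B2]; [lra|].
      apply Rabs_def1; unfold minus, plus, opp; simpl; lra.
    + intros t Ht. exact (solution_a_eq _ _ _ _ t hlx Hs Ht).
    + intros Q [M HM].
      assert (HM1 : 0 < Rmax M 1) by (apply Rlt_le_trans with (2 := Rmax_r M 1); lra).
      apply at_left_intro with (Rmin (/ Rmax M 1) (1 / 4)).
      { apply Rmin_pos; [apply Rinv_0_lt_compat, HM1|lra]. }
      intros y Hy. apply HM.
      generalize (Rmin_l (/ Rmax M 1) (1 / 4)) (Rmin_r (/ Rmax M 1) (1 / 4)).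
      intros M1 M2.
      destruct (B y) as [B1 B2]; [lra|].
      destruct (K y) as [Ka [Kh [Kd _]]]; [lra|]. unfold height in Kh.
      apply (Rle_lt_trans _ _ _ (Rmax_l M 1)).
      apply Rmult_lt_reg_r with (delta y); [exact B1|].
      apply Rlt_le_trans with 1.
      * apply Rlt_le_trans with (Rmax M 1 * / Rmax M 1);
          [apply Rmult_lt_compat_l; lra|rewrite Rinv_r; lra].
      * assert (0 <= a y * delta y * delta y)
          by (repeat apply Rmult_le_pos; lra).
        lra.
Qed.
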